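(* Let $\Sigma$ be a finite non-empty alphabet, let $w\in\Sigma^*$, and let $I=\Sigma^*w\Sigma^*$ be the principal ideal language generated by $w$. Then $rc(I)=|w|+1$, where $rc(I)$ is the reset complexity of $I$.
   Context: A deterministic finite automaton (semiautomaton) is a triple $\mathscr{A}=\langle Q,\Sigma,\delta\rangle$ with $Q$ a finite non-empty set of states and $\delta:Q\times\Sigma\to Q$ a totally defined transition function, extended to $Q\times\Sigma^*\to Q$ in the usual way. A word $u\in\Sigma^*$ is a reset word for $\mathscr{A}$ if $\delta(q,u)=\delta(q',u)$ for all $q,q'\in Q$; $\mathscr{A}$ is synchronizing if it has a reset word, and $\mathrm{Syn}(\mathscr{A})$ denotes the set of all reset words of $\mathscr{A}$. For a regular two-sided ideal $I$ of $\Sigma^*$ (i.e. $I\neq\emptyset$ and $\Sigma^*I\Sigma^*\subseteq I$), the reset complexity $rc(I)$ is the minimal possible number of states of a synchronizing automaton $\mathscr{A}$ over $\Sigma$ with $\mathrm{Syn}(\mathscr{A})=I$. $|w|$ is the length of $w$. *)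

(* Defs.v *)
From mathcomp Require Import all_boot.

Set Implicit Arguments.
Unset Strict Implicit.
Unset Printing Implicit Defensive.

Record semiautomaton (Sigma : finType) := Semiautomaton {
  state : finType;
  state_nonempty : 0 < #|state|;
  delta : state -> Sigma -> state
}.

(* Words act on the right: the first letter of [u] is read first. *)
Definition delta_star (Sigma : finType) (A : semiautomaton Sigma)
    (q : state A) (u : seq Sigma) : state A :=
  foldl (@delta Sigma A) q u.

Definition language (Sigma : finType) := seq Sigma -> Prop.

Definition same_language (Sigma : finType) (L1 L2 : language Sigma) : Prop :=
  forall u, L1 u <-> L2 u.

Definition Syn (Sigma : finType) (A : semiautomaton Sigma) : language Sigma :=
  fun u => forall q q' : state A, delta_star q u = delta_star q' u.

Definition synchronizing (Sigma : finType) (A : semiautomaton Sigma) : Prop :=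
  exists u, Syn A u.

Definition principal_ideal (Sigma : finType) (w : seq Sigma) : language Sigma :=
  fun u => exists x y : seq Sigma, u = x ++ w ++ y.

(* [is_rc I n] means rc(I) = n. The reset complexity is a minimum over a set of
   automata which is not known to be inhabited for an arbitrary language, so it
   is given by its graph: [n] is attained, and is a lower bound. *)
Definition is_rc (Sigma : finType) (I : language Sigma) (n : nat) : Prop :=
  (exists A : semiautomaton Sigma,
     [/\ synchronizing A, same_language (Syn A) I & #|state A| = n]) /\
  (forall A : semiautomaton Sigma,
     synchronizing A -> same_language (Syn A) I -> n <= #|state A|).

Lemma is_rc_unique (Sigma : finType) (I : language Sigma) (m n : nat) :
  is_rc I m -> is_rc I n -> m = n.
Proof.
move=> [[A [sA IA <-]] minA] [[B [sB IB <-]] minB].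
by apply/eqP; rewrite eqn_leq minA ?minB.
Qed.

(* Main.v *)
(* The upper bound is the Knuth-Morris-Pratt automaton of w, in which the full
   match is made absorbing.

   For the lower bound, call t a separator if w is a factor of u t v only when
   it is a factor of u or of v. If w = a^i s or w = s a^j with |s| <= 1, there
   may be no separator, but the chain of images Q > Qa > Qa^2 > ... is strictly
   decreasing and long enough. Otherwise one of c^N, a^N b^N, abab is a
   separator, for suitable letters a, b, c.

   Given a separator, some word e avoiding w has minimal rank r = |Qe| among
   the words avoiding w and is itself a separator; r > 1 as e is not a reset
   word. Let p be a prime divisor of r, and consider over F_p the indicator
   vectors of the sets S_i = Q e w_1...w_i for 0 <= i < |w|. They have
   coordinate sum r = 0. The word y e maps S_i bijectively onto Qe if
   w_1...w_i y avoids w, and to one state, of multiplicity r = 0, otherwise.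
   Hence a linear relation with coefficients c_i gives that the c_i for which
   w_1...w_i y avoids w add up to 0, for all y; letting y range over the
   suffixes of w yields c = 0. So |w| independent vectors lie in a space of
   dimension |Q| - 1. *)
Require Import Defs.
From mathcomp Require Import all_boot all_algebra.

Set Implicit Arguments.
Unset Strict Implicit.
Unset Printing Implicit Defensive.

(** * Combinatorics on words: separators and a case split on [w] *)

Section Words.

Variable T : eqType.
Implicit Types (a b c : T) (s t u v w : seq T).

Lemma levi s1 s2 s3 s4 : s1 ++ s2 = s3 ++ s4 ->
  (exists d, s1 = s3 ++ d /\ s4 = d ++ s2) \/
  (exists d, s3 = s1 ++ d /\ s2 = d ++ s4).
Proof.
elim: s1 s3 => [|x s1 IH] [|y s3] /=.
- by move=> ->; left; exists [::].
- by move=> ->; right; exists (y :: s3).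
- by move=> <-; left; exists (x :: s1).
- by case=> -> /IH [] [d [-> ->]]; [left | right]; exists d.
Qed.

Lemma suffix_size_le s t u :
  suffix s u -> suffix t u -> size s <= size t -> suffix s t.
Proof.
move=> /suffixP [x ->] /suffixP [y /levi [] [d [_ ->]]].
  by rewrite suffix_suffix.
rewrite size_cat -{2}[size t]add0n leq_add2r leqn0 => /nilP ->.
exact: suffix_refl.
Qed.

Lemma cat_eq_nseq n c s1 s2 : nseq n c = s1 ++ s2 ->
  s1 = nseq (size s1) c /\ s2 = nseq (size s2) c.
Proof.
move=> E; have := all_pred1_nseq c n; rewrite E all_cat.
by case/andP => /all_pred1P ? /all_pred1P.
Qed.

Definition separator w t :=
  forall u v, infix w (u ++ t ++ v) -> infix w u || infix w v.

(** By Levi's lemma, an occurrence of [w] in [u ++ t ++ v] that lies in neither [u] nor [v] runs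
    over one end of [t], lies inside [t], or contains [t]; each hypothesis excludes one of these. *)
Lemma separatorI w t :
    (forall d e, t = d ++ e -> suffix d w -> d = [::]) ->
    (forall d e, t = d ++ e -> prefix e w -> e = [::]) ->
    ~~ infix w t -> ~~ infix t w ->
  separator w t.
Proof.
move=> tPw tSw wNt tNw u v /infixP [x [y]] /levi.
case=> [[d [-> /levi]]|[d [_ /levi]]].
- case=> [[e [dE /levi]]|[e [-> _]]]; last by rewrite infix_infix.
  case=> [[f [tE _]]|[f [eE _]]].
    have e0 : e = [::] by apply: (tPw e f) => //; rewrite dE suffix_suffix.
    by move: dE; rewrite e0 cats0 => ->; rewrite suffix_infix.
  by case/negP: tNw; rewrite dE eE infix_infix.
- case=> [[e [tE /levi]]|[e [_ ->]]]; last by rewrite infix_infix orbT.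
  case=> [[f [wE ->]]|[f [eE _]]]; last first.
    by case/negP: wNt; rewrite tE eE infix_infix.
  have e0 : e = [::] by apply: (tSw d e) => //; rewrite wE prefix_prefix.
  by rewrite wE e0 prefix_infix orbT.
Qed.


Lemma suffix_nseq_last x c n w : suffix (nseq n c) w -> last x w != c -> n = 0.
Proof.
case: n => // n /suffixP [y ->]; rewrite last_cat /= => /eqP [].
by elim: n.
Qed.

Lemma prefix_nseq_head x c n w : prefix (nseq n c) w -> head x w != c -> n = 0.
Proof. by case: n => // n /prefixP [y ->] /eqP []. Qed.

Lemma separator_nseq a c w :
    head c w != c -> last c w != c -> c \in w ->
  separator w (nseq (size w).+1 c).
Proof.
move=> hw lw cw; apply: separatorI.
- move=> d e /cat_eq_nseq [-> _] /suffix_nseq_last /(_ lw).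
  by move/size0nil => ->.
- move=> d e /cat_eq_nseq [_ ->] /prefix_nseq_head /(_ hw).
  by move/size0nil => ->.
- apply/negP => /mem_infix wc; case: w hw {lw} cw wc => // x w xNc _.
  by move/(_ x (mem_head _ _)); rewrite mem_nseq (negPf xNc) andbF.
- by apply/negP => /size_infix; rewrite size_nseq ltnn.
Qed.

Lemma infix_nseq2 a b i j w :
    head b w = a -> last a w = b -> a != b ->
    infix w (nseq i a ++ nseq j b) ->
  exists i' j', w = nseq i' a ++ nseq j' b.
Proof.
move=> hw lw aNb /infixP [x [y /levi]].
case=> [[d [/cat_eq_nseq [_ ->] /levi]]|[d [_ /cat_eq_nseq [_]]]]; last first.
  move/esym/cat_eq_nseq=> [wE _].
  by exists 0, (size w).
case=> [[e [wE /cat_eq_nseq [eE _]]]|[e [/cat_eq_nseq [wE _] _]]].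
  by exists (size d), (size e); rewrite -eE.
by exists (size w), 0; rewrite cats0.
Qed.

Lemma separator_nseq2 a b w :
    head b w = a -> last a w = b -> a != b ->
    ~~ infix w (nseq (size w) a ++ nseq (size w) b) ->
  separator w (nseq (size w) a ++ nseq (size w) b).
Proof.
move=> hw lw aNb wN.
have w0 : 0 < size w.
  by case: (w) hw aNb => //= ->; rewrite eqxx.
apply: separatorI => //.
(* Being a suffix of [w], the prefix [d] has length at most [size w], so it stays in the block of
   [a], whereas [w] ends in [b]. The next case is symmetric. *)
- move=> d e dE dw; suff dE' : d = nseq (size d) a.
    move: dw; rewrite dE' => /suffix_nseq_last => /(_ a).
    by rewrite lw eq_sym aNb => -> //.
  case/levi: dE => [[f [/cat_eq_nseq [] //]]|[f [dE _]]].
  move/size_suffix: dw; rewrite dE size_cat size_nseq -{2}[size w]addn0.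
  by rewrite leq_add2l leqn0 => /nilP ->; rewrite cats0 addn0.
- move=> d e dE ew; suff eE' : e = nseq (size e) b.
    move: ew; rewrite eE' => /prefix_nseq_head => /(_ b).
    by rewrite hw aNb => -> //.
  case/levi: dE => [[f [_ eE]]|[f [_ /cat_eq_nseq [] //]]].
  move/size_prefix: ew; rewrite eE size_cat size_nseq -{2}[size w]add0n.
  by rewrite leq_add2r leqn0 => /nilP ->.
- apply/negP => /size_infix; rewrite size_cat !size_nseq -{3}[size w]addn0.
  by rewrite leq_add2l leqNgt w0.
Qed.

Lemma infix_abab a b i j :
  a != b -> ~~ infix [:: a; b; a; b] (nseq i a ++ nseq j b).
Proof.
move=> aNb; apply/negP => /infixP [x [y]].
rewrite (catA x [:: a; b] ([:: a; b] ++ y)) => /levi [] [d [E1 E2]].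
  have: b \in nseq i a by rewrite E1 !(mem_cat, inE) eqxx !orbT.
  by rewrite mem_nseq eq_sym (negPf aNb) andbF.
have: a \in nseq j b by rewrite E2 !(mem_cat, inE) eqxx !orbT.
by rewrite mem_nseq (negPf aNb) andbF.
Qed.

(** As both exponents are at least 2, [w] begins with [aa] and ends with [bb]. A nonempty prefix of
    [abab] ends in [a] or is followed back by [ab], never by [bb]; dually, no nonempty suffix fits
    the start of [w]. *)
Lemma separator_abab a b i j :
  a != b -> separator (nseq i.+2 a ++ nseq j.+2 b) [:: a; b; a; b].
Proof.
move=> aNb; have bNa : b != a by rewrite eq_sym.
have wE : nseq i.+2 a ++ nseq j.+2 b =
    rcons (rcons (nseq i.+2 a ++ nseq j b) b) b.
  by rewrite -!cats1 -!catA -(addn2 j) nseqD.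
have sab x : suffix (x ++ [:: a; b]) (nseq i.+2 a ++ nseq j.+2 b) = false.
  by rewrite wE -(cat_rcons a) cats1 !suffix_rcons eqxx (negPf aNb).
have sa x : suffix (rcons x a) (nseq i.+2 a ++ nseq j.+2 b) = false.
  by rewrite wE !suffix_rcons (negPf aNb).
apply: separatorI; last exact: infix_abab.
- case=> [|x1 [|x2 [|x3 [|x4 [|x5 d]]]]] e //=.
  + by case=> <- _; rewrite (sa [::]).
  + by case=> <- <- _; rewrite (sab [::]).
  + by case=> <- <- <- _; rewrite (sa [:: a; b]).
  + by case=> <- <- <- <- _; rewrite (sab [:: a; b]).
- case=> [|x1 [|x2 [|x3 [|x4 [|x5 d]]]]] e //=.
  + by move=> <- /=; rewrite eqxx (negPf bNa).
  + by case=> _ <- /=; rewrite (negPf bNa).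
  + by case=> _ _ <- /=; rewrite eqxx (negPf bNa).
  + by case=> _ _ _ <- /=; rewrite (negPf bNa).
  + by case=> _ _ _ _ <-.
- by rewrite /= eqxx (negPf aNb).
Qed.

(** Compare the first letter [a] with the last letter [b]. If they agree, [w] is a power of [a] or
    contains another letter [c], a long power of which separates. If they differ, a^N b^N separates
    unless [w] is some a^i b^j; then an exponent at most 1 gives a chain case, and [abab] separates
    otherwise. *)
Lemma word_cases w :
  [\/ exists a i s, w = nseq i a ++ s /\ size s <= 1,
      exists a j s, w = s ++ nseq j a /\ size s <= 1 |
      exists t, separator w t].
Proof.
case: w => [|a w0]; first by apply: Or33; exists [::] => u v _; rewrite infix0s.
set w := a :: w0; pose b := last a w.
have [ba|aNb] := eqVneq a b.
  have [|] := boolP (all (pred1 a) w).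
    move/all_pred1P => wE; apply: Or31; exists a, (size w), [::].
    by rewrite cats0.
  case/allPn => c cw /= cNa; apply: Or33; exists (nseq (size w).+1 c).
  have aNc : a != c by rewrite eq_sym.
  by apply: separator_nseq => //; rewrite -[last c w]/b -ba.
set t := nseq (size w) a ++ nseq (size w) b.
have [abw|abw] := boolP (infix w t); last first.
  by apply: Or33; exists t; apply: separator_nseq2.
have [i [[|[|j]] ->]] :=
  infix_nseq2 (erefl : head b w = a) (erefl : last a w = b) aNb abw.
- by apply: Or31; exists a, i, [::].
- by apply: Or31; exists a, i, [:: b].
case: i => [|[|i]].
- by apply: Or32; exists b, j.+2, [::].
- by apply: Or32; exists b, j.+2, [:: a].
by apply: Or33; exists [:: a; b; a; b]; apply: separator_abab.
Qed.

End Words.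

(** * Linear algebra: a dimension bound and a triangular system *)

Section Independence.

Import GRing.Theory.
Local Open Scope ring_scope.

Lemma sumr_mem (R : pzSemiRingType) (I : finType) (B : {set I}) :
  \sum_i (i \in B)%:R = #|B|%:R :> R.
Proof.
rewrite -natr_sum -sum1_card [in RHS]big_mkcond.
by congr (_%:R); apply: eq_bigr => i _; case: (i \in B).
Qed.

(** The vectors are the rows of a matrix that kills the all-ones column, which has rank 1; so its
    rank [k] is at most [#|Q| - 1]. *)
Lemma independent_sum_zero_ltn (F : fieldType) (Q : finType) (k : nat)
    (f : 'I_k -> Q -> F) :
    (0 < #|Q|)%N -> (forall i, \sum_q f i q = 0) ->
    (forall c : 'I_k -> F,
       (forall q, \sum_i c i * f i q = 0) -> forall i, c i = 0) ->
  (k < #|Q|)%N.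
Proof.
move=> Q_gt0 f0 f_free.
pose M := \matrix_(i < k, j < #|Q|) f i (enum_val j).
have M_free : row_free M.
  apply: inj_row_free => v vM; apply/rowP => i; rewrite mxE.
  apply: (f_free (fun i => v ord0 i)) => q.
  have /rowP/(_ (enum_rank q)) := vM; rewrite !mxE => vMq.
  by rewrite -[RHS]vMq; apply: eq_bigr => j _; rewrite mxE enum_rankK.
have M1 : M *m (const_mx 1 : 'cV_#|Q|) = 0.
  apply/matrixP => i j; rewrite !mxE -[RHS](f0 i).
  rewrite [RHS](reindex _ (onW_bij _ (enum_val_bij Q))) /=.
  by apply: eq_bigr => q _; rewrite !mxE mulr1.
have := mulmx0_rank_max M1; rewrite (eqP M_free).
suff -> : \rank (const_mx 1 : 'cV[F]_#|Q|) = 1%N by rewrite addn1.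
apply/eqP; rewrite eqn_leq rank_leq_col lt0n mxrank_eq0.
apply/eqP => /matrixP /(_ (Ordinal Q_gt0) ord0); rewrite !mxE => /eqP.
by rewrite oner_eq0.
Qed.

(* The overlap sets [{i | infix w (take i w ++ drop j w)}] are contained in
   [{i | j <= i}] and contain [j]: they form a triangular system. *)
Lemma overlap_sums_eq0 (F : zmodType) (T : eqType) (w : seq T)
    (c : 'I_(size w) -> F) :
    (forall y, \sum_(i < size w | ~~ infix w (take i w ++ y)) c i = 0) ->
  forall i, c i = 0.
Proof.
move=> c0; have take_inf (i : 'I_(size w)) y :
    infix w (take i w ++ y) -> (size w <= i + size y)%N.
  by move/size_infix; rewrite size_cat size_takel // ltnW.
have csum : \sum_i c i = 0.
  rewrite -[RHS](c0 [::]) big_mkcond [RHS]big_mkcond /=; apply: eq_bigr => i _.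
  by case: ifPn => // /negbNE /take_inf; rewrite addn0 leqNgt ltn_ord.
have overlap0 y : \sum_(i < size w | infix w (take i w ++ y)) c i = 0.
  move: csum; rewrite (bigID (fun i : 'I__ => infix w (take i w ++ y))) /=.
  by rewrite c0 addr0.
suff IH n (j : 'I_(size w)) : (size w - j <= n)%N -> c j = 0.
  by move=> i; apply: IH.
elim: n j => [|n IH] j; first by rewrite leqn0 subn_eq0 leqNgt ltn_ord.
move=> jn; rewrite -[RHS](overlap0 (drop j w)) (bigD1 j) /=; last first.
  by rewrite cat_take_drop infix_refl.
rewrite big1 ?addr0 // => i /andP [/take_inf wi ij]; apply: IH.
move: wi; rewrite size_drop => wi.
have {ij} : (j < i)%N.
  rewrite ltn_neqAle eq_sym ij -(leq_add2r (size w - j)) subnKC //.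
  exact: ltnW.
move=> ji; rewrite -ltnS; apply: leq_trans jn; exact: ltn_sub2l.
Qed.

End Independence.

(** * Images and ranks of words in an automaton *)

Section Automaton.

Variables (Sigma : finType) (A : semiautomaton Sigma).
Implicit Types (u v w t x y : seq Sigma) (q : state A).

Definition image_of u : {set state A} := [set delta_star q u | q : state A].

Lemma delta_star_cat q u v :
  delta_star q (u ++ v) = delta_star (delta_star q u) v.
Proof. exact: foldl_cat. Qed.

Lemma image_cat u v : image_of (u ++ v) = [set delta_star q v | q in image_of u].
Proof.
by rewrite /image_of -imset_comp; apply: eq_imset => q; rewrite /= delta_star_cat.
Qed.

Lemma image_cat_sub u v : image_of (u ++ v) \subset image_of v.
Proof.
by rewrite image_cat; apply/subsetP => _ /imsetP [q _ ->]; apply: imset_f.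
Qed.

Lemma image_gt0 u : 0 < #|image_of u|.
Proof.
have /card_gt0P [q _] := state_nonempty A.
by apply/card_gt0P; exists (delta_star q u); apply: imset_f.
Qed.

Lemma Syn_image u : Syn A u <-> #|image_of u| <= 1.
Proof.
split=> [uS|/card_le1_eqP uS q q']; last by apply: uS; apply: imset_f.
by apply/card_le1_eqP => _ _ /imsetP [q _ ->] /imsetP [q' _ ->]; apply: uS.
Qed.

Lemma card_image_catl u v : #|image_of (u ++ v)| <= #|image_of u|.
Proof. by rewrite image_cat leq_imset_card. Qed.

Lemma card_image_catr u v : #|image_of (u ++ v)| <= #|image_of v|.
Proof. exact/subset_leq_card/image_cat_sub. Qed.

Lemma image_nseq_stable c l m :
  image_of (nseq l.+1 c) = image_of (nseq l c) -> l <= m ->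
  image_of (nseq m c) = image_of (nseq l c).
Proof.
move=> lE /subnKC <-; elim: (m - l) => [|d IH]; first by rewrite addn0.
by rewrite addnS -addn1 nseqD image_cat IH -image_cat -nseqD addn1.
Qed.

Lemma image_nseq_chain c m :
    (forall l, l < m -> image_of (nseq l.+1 c) <> image_of (nseq l c)) ->
  m + #|image_of (nseq m c)| <= #|state A|.
Proof.
elim: m => [|m IH] neq; first by rewrite add0n max_card.
have {IH} := IH (fun l lm => neq l (ltnW lm)); apply: leq_trans.
rewrite addSnnS leq_add2l; apply: proper_card.
rewrite properEneq -{2}addn1 addnC nseqD image_cat_sub andbT.
by apply/eqP; apply: neq.
Qed.

(** * Lower bound on the number of states *)

Section LowerBound.

Variable w : seq Sigma.
Hypothesis SynE : forall u, Syn A u <-> infix w u.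

Lemma image_gt1 u : ~~ infix w u -> 1 < #|image_of u|.
Proof. by rewrite ltnNge; apply: contra => /Syn_image /SynE. Qed.

Lemma image_le1 u : infix w u -> #|image_of u| <= 1.
Proof. by move=> /SynE /Syn_image. Qed.

(** If the chain of images stopped at some [l < i], then [nseq l c ++ s] would have the image of [w]
    and be a reset word shorter than [w]. When [s] is one letter, the missing unit comes from
    [nseq i c] avoiding [w], hence having rank at least 2. *)
Lemma nseq_cat_bound c i s :
  w = nseq i c ++ s -> size s <= 1 -> size w < #|state A|.
Proof.
move=> wE s1; rewrite wE size_cat size_nseq.
have chain : i + #|image_of (nseq i c)| <= #|state A|.
  apply: image_nseq_chain => l li lE.
  have wl : infix w (nseq l c ++ s).
    apply/SynE/Syn_image; rewrite image_cat.
    rewrite -(image_nseq_stable lE (ltnW li)) -image_cat -wE.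
    exact/image_le1/infix_refl.
  move/size_infix: wl.
  by rewrite wE !size_cat !size_nseq leq_add2r leqNgt li.
apply: leq_trans chain; rewrite -addnS leq_add2l.
case: (posnP (size s)) => [->|s_gt0]; first exact: image_gt0.
apply: leq_ltn_trans s1 _; apply: image_gt1; apply/negP => /size_infix.
by rewrite wE size_cat size_nseq -{2}[i]addn0 leq_add2l leqNgt s_gt0.
Qed.

Lemma cat_nseq_bound c j s :
  w = s ++ nseq j c -> size s <= 1 -> size w < #|state A|.
Proof.
move=> wE s1; rewrite wE size_cat size_nseq.
have chain : j + #|image_of (nseq j c)| <= #|state A|.
  apply: image_nseq_chain => l lj lE.
  have lE' := image_nseq_stable lE (ltnW lj).
  have jE : nseq j c = nseq l c ++ nseq (j - l) c.
    by rewrite -nseqD subnKC // ltnW.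
  (* [c] permutes [image_of (nseq l c)], so the last [j - l] letters of [w]
     merge nothing there. *)
  have inj_c : {in image_of (nseq l c) &,
      injective (fun q => delta_star q (nseq (j - l) c))}.
    by apply/imset_injP; rewrite -image_cat -jE lE'.
  have wl : infix w (s ++ nseq l c).
    apply/SynE/Syn_image.
    have <- : #|image_of w| = #|image_of (s ++ nseq l c)|.
      rewrite wE jE catA image_cat; apply: card_in_imset => q q' qs q's.
      by apply: inj_c; apply: (subsetP (image_cat_sub s _)).
    exact/image_le1/infix_refl.
  move/size_infix: wl.
  by rewrite wE !size_cat !size_nseq leq_add2l leqNgt lj.
apply: leq_trans chain; rewrite addnC -addnS leq_add2l.
case: (posnP (size s)) => [->|s_gt0]; first exact: image_gt0.
apply: leq_ltn_trans s1 _; apply: image_gt1; apply/negP => /size_infix.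
by rewrite wE size_cat size_nseq -{2}[j]add0n leq_add2r leqNgt s_gt0.
Qed.

Import GRing.Theory.

(** The left side is a coordinate of the pushforward under [y] of the indicator of [image_of x]. If
    [w] occurs in [x ++ y], all of [image_of x] is merged and a nonempty fiber has size 0 modulo
    [p]; otherwise equality of ranks makes [y] injective there. *)
Lemma fiber_count (p : nat) x y q :
    prime p -> p %| #|image_of x| ->
    (~~ infix w (x ++ y) -> #|image_of (x ++ y)| = #|image_of x|) ->
  (#|[set q' in image_of x | delta_star q' y == q]|%:R =
   (~~ infix w (x ++ y) && (q \in image_of (x ++ y)))%:R :> 'F_p)%R.
Proof.
move=> p_pr px rank_xy; have [xy|xy] /= := boolP (infix w (x ++ y)).
  have /SynE xyS := xy; apply/eqP; rewrite -(dvdn_pcharf (pchar_Fp p_pr)).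
  have [->|[q0]] := set_0Vmem [set q' in image_of x | delta_star q' y == q].
    by rewrite cards0 dvdn0.
  rewrite inE => /andP [/imsetP [q1 _ ->] /eqP <-].
  rewrite (_ : [set _ in _ | _] = image_of x) //.
  apply/setP => q2; rewrite inE andb_idr // => /imsetP [q3 _ ->].
  by rewrite -!delta_star_cat; apply/eqP; apply: xyS.
have inj_y : {in image_of x &, injective (fun q => delta_star q y)}.
  by apply/imset_injP; rewrite -image_cat rank_xy.
congr (_%:R)%R; rewrite image_cat.
have [/imsetP [q0 q0x ->]|qN] := boolP (q \in _).
  apply/eqP/cards1P; exists q0; apply/setP => q1; rewrite !inE.
  apply/andP/eqP => [[q1x /eqP]|->]; first exact: inj_y.
  by rewrite q0x eqxx.
apply/eqP; rewrite cards_eq0; apply/eqP/setP => q1; rewrite !inE.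
by apply: contraNF qN => /andP [q1x /eqP <-]; apply/imsetP; exists q1.
Qed.

Lemma minimal_rank_bound e :
    ~~ infix w e ->
    separator w e ->
    (forall u, ~~ infix w u -> #|image_of e| <= #|image_of u|) ->
  size w < #|state A|.
Proof.
move=> eN sep_e min_e.
have sepN x y : ~~ infix w x -> ~~ infix w y -> ~~ infix w (x ++ e ++ y).
  by move=> xN yN; apply/negP => /sep_e; rewrite (negPf xN) (negPf yN).
have w_gt0 : 0 < size w by case: (w) eN => [|//]; rewrite infix0s.
pose p := pdiv #|image_of e|.
have p_pr : prime p by apply/pdiv_prime/image_gt1.
pose S (i : 'I_(size w)) := image_of (e ++ take i w).
have take_N (i : 'I_(size w)) : ~~ infix w (take i w).
  apply/negP => /size_infix.
  by rewrite size_takel ?(ltnW (ltn_ord i)) // leqNgt ltn_ord.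
have nil_N : ~~ infix w [::] by rewrite infixs0 -size_eq0 -lt0n.
have rankE z : ~~ infix w z -> #|image_of (e ++ z)| = #|image_of e|.
  move=> zN; apply/eqP; rewrite eqn_leq card_image_catl min_e //.
  exact: (sepN [::]).
have endE z : ~~ infix w z -> image_of (z ++ e) = image_of e.
  move=> zN; apply/eqP; rewrite eqEcard image_cat_sub min_e //.
  by have := sepN _ _ zN nil_N; rewrite cats0.
apply: (@independent_sum_zero_ltn 'F_p _ _ (fun i q => (q \in S i)%:R)%R).
- exact: state_nonempty.
- move=> i; rewrite sumr_mem; apply/eqP.
  by rewrite -(dvdn_pcharf (pchar_Fp p_pr)) rankE ?take_N // pdiv_dvd.
move=> c cS; apply: overlap_sums_eq0 => y.
(* Reading [y ++ e] instead of [y] makes all images of full rank equal to [image_of e], so a single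
   coordinate [q0] serves every [i]. *)
have /card_gt0P [q0 q0e] := image_gt0 e.
have cut_e (i : 'I_(size w)) :
    infix w ((e ++ take i w) ++ (y ++ e)) = infix w (take i w ++ y).
  rewrite -catA; apply/idP/idP => [wi|]; last first.
    by move=> wi; rewrite (catA (take i w)); apply/infix_catl/infix_catr.
  have := sep_e [::] (take i w ++ (y ++ e)).
  rewrite wi (negPf nil_N) => /(_ isT) /= wi'.
  have := sep_e (take i w ++ y) [::].
  by rewrite cats0 -catA wi' (negPf nil_N) orbF => ->.
have fiberE (i : 'I_(size w)) :
    ((~~ infix w (take i w ++ y))%:R =
     #|[set q in S i | delta_star q (y ++ e) == q0]|%:R :> 'F_p)%R.
  rewrite (fiber_count _ p_pr) ?rankE ?pdiv_dvd // ?cut_e; last first.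
    move=> iyN; rewrite -catA (catA (take i w)) catA endE ?rankE //.
    by rewrite -[e ++ _]cats0 -catA; apply: (sepN [::]); rewrite ?cats0.
  congr (nat_of_bool _)%:R%R; case: (boolP (infix w _)) => //= iyN.
  rewrite -catA (catA (take i w)) catA endE ?q0e //.
  by rewrite -[e ++ _]cats0 -catA; apply: (sepN [::]); rewrite ?cats0.
rewrite big_mkcond /=.
under eq_bigr => i _.
  rewrite -mulrb -mulr_natr fiberE -sumr_mem mulr_sumr.
  over.
(* After the exchange, each state sent to [q0] contributes the given linear relation at that state,
   and the others contribute nothing. *)
rewrite exchange_big /= big1 // => q _.
have [q_q0|q_q0] := eqVneq (delta_star q (y ++ e)) q0.
  by rewrite -[RHS](cS q); apply: eq_bigr => i _; rewrite inE q_q0 eqxx andbT.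
by apply: big1 => i _; rewrite inE (negPf q_q0) andbF mulr0.
Qed.

(** Assuming too few states, induction on [r] shows that no word of rank at most [r] avoids [w]. A
    least-rank word [u] avoiding [w] is padded to [t ++ u ++ t], which is again a separator, avoids
    [w] since [w] is nonempty, and has no larger rank. *)
Lemma separator_bound t : separator w t -> size w < #|state A|.
Proof.
move=> sep_t; case: (posnP (size w)) => [->|w_gt0]; first exact: state_nonempty.
have nil_N : ~~ infix w [::] by rewrite infixs0 -size_eq0 -lt0n.
rewrite ltnNge; apply/negP => Q_small.
suff no_rank r u : #|image_of u| <= r -> infix w u.
  by have := no_rank _ [::] (leqnn _); rewrite (negPf nil_N).
elim: r u => [|r IH] u ur; first by have := leq_trans (image_gt0 u) ur.
apply/negPn/negP => uN.
have tut_sep : separator w (t ++ u ++ t).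
  move=> x y; rewrite -!catA => /sep_t /orP [->//|/sep_t].
  by rewrite (negPf uN) => /= ->; rewrite orbT.
suff : size w < #|state A| by rewrite ltnNge Q_small.
apply: (minimal_rank_bound _ tut_sep).
  apply/negP => tut; have := tut_sep [::] [::].
  by rewrite cats0 tut (negPf nil_N) => /(_ isT).
move=> v vN; apply: leq_trans (_ : r.+1 <= _); last first.
  by rewrite ltnNge; apply: contra vN => /IH.
apply: leq_trans ur; apply: leq_trans (card_image_catr _ _) _.
exact: card_image_catl.
Qed.

Lemma principal_lower_bound : size w < #|state A|.
Proof.
case: (word_cases w) => [[a [i [s [wE s1]]]]|[a [j [s [wE s1]]]]|[t]].
- exact: nseq_cat_bound wE s1.
- exact: cat_nseq_bound wE s1.
- exact: separator_bound.
Qed.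

End LowerBound.

End Automaton.

(** * Upper bound: the Knuth-Morris-Pratt automaton *)

Section UpperBound.

Variables (Sigma : finType) (w : seq Sigma).
Implicit Types (s u : seq Sigma).

Definition overlap s : 'I_(size w).+1 :=
  [arg max_(i > ord0 | suffix (take i w) s) i].

Lemma overlap_suffix s : suffix (take (overlap s) w) s.
Proof. by rewrite /overlap; case: arg_maxnP => //=; rewrite take0 suffix0s. Qed.

Lemma overlap_max s m :
  m <= size w -> suffix (take m w) s -> m <= overlap s.
Proof.
rewrite -ltnS => mw ms; rewrite /overlap.
case: arg_maxnP => [|i _ /(_ (Ordinal mw)) /=]; last exact.
by rewrite take0 suffix0s.
Qed.

Lemma overlap_lt s : ~~ infix w s -> overlap s < size w.
Proof.
rewrite ltn_neqAle -ltnS ltn_ord andbT; apply: contra => /eqP sE.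
by have := overlap_suffix s; rewrite sE take_size => /suffixW.
Qed.

Lemma overlap_take (i : 'I_(size w).+1) : overlap (take i w) = i.
Proof.
have i_le (j : 'I_(size w).+1) : j <= size w by rewrite -ltnS.
apply/val_inj/eqP; rewrite eqn_leq.
rewrite [_ <= overlap _]overlap_max ?suffix_refl ?i_le // andbT.
by have /size_suffix := overlap_suffix (take i w); rewrite !size_takel.
Qed.

(** A nonempty prefix of [w] ending [rcons s c] is a shorter prefix ending [s], followed by [c].
    That shorter prefix is no longer than [overlap s], so remembering [take (overlap s) w] loses
    nothing. *)
Lemma overlap_rcons s c :
  ~~ infix w s -> overlap (rcons (take (overlap s) w) c) = overlap (rcons s c).
Proof.
move=> sN; have ov_le u : overlap u <= size w by rewrite -ltnS.
have sub m : m <= size w ->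
    suffix (take m w) (rcons (take (overlap s) w) c)
    = suffix (take m w) (rcons s c).
  case: m => [|m] mw; first by rewrite take0 !suffix0s.
  rewrite (take_nth c mw) !suffix_rcons; case: eqP => //= _.
  apply/idP/idP => ms; first exact: suffix_trans ms (overlap_suffix s).
  apply: (suffix_size_le ms (overlap_suffix s)).
  by rewrite !size_takel ?(ltnW mw) // overlap_max // ltnW.
apply/val_inj/eqP; rewrite eqn_leq; apply/andP; split.
  by apply: overlap_max; rewrite -?sub ?overlap_suffix ?ov_le.
by apply: overlap_max; rewrite ?sub ?overlap_suffix ?ov_le.
Qed.

Definition kmp_delta (i : 'I_(size w).+1) c : 'I_(size w).+1 :=
  if i == ord_max then ord_max else overlap (rcons (take i w) c).

Lemma kmp_nonempty : 0 < #|'I_(size w).+1|.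
Proof. by rewrite card_ord. Qed.

Definition kmp : semiautomaton Sigma := Semiautomaton kmp_nonempty kmp_delta.

Lemma kmp_absorbing u :
  delta_star (A := kmp) (ord_max : 'I_(size w).+1) u = ord_max.
Proof. by elim: u => //= c u IH; rewrite /kmp_delta eqxx. Qed.

Lemma kmp_run s u :
    ~~ infix w s ->
  (delta_star (A := kmp) (overlap s) u == ord_max) = infix w (s ++ u).
Proof.
elim: u s => [|c u IH] s sN.
  rewrite cats0 (negPf sN) /=; apply/negbTE.
  by rewrite -val_eqE /= neq_ltn overlap_lt.
rewrite -cat_rcons /= /kmp_delta ifN; last first.
  by rewrite -val_eqE /= neq_ltn overlap_lt.
rewrite overlap_rcons //.
have [sc|] := boolP (infix w (rcons s c)); last exact: IH.
(* Since [s] avoids [w], the first occurrence of [w] ends exactly at this [c]. *)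
have -> : overlap (rcons s c) = ord_max.
  apply/val_inj/eqP; rewrite eqn_leq -ltnS ltn_ord /=.
  apply: overlap_max => //; rewrite take_size.
  by move: sc; rewrite infix_rconsl (negPf sN) orbF.
by rewrite kmp_absorbing eqxx infix_catr.
Qed.

(** The absorbing state forces any common target to be [ord_max], and the run from [overlap [::]]
    gets there only by meeting [w]. Conversely, state [q] is [overlap (take q w)], so a run from it
    behaves as if [take q w] had been read before [u]. *)
Lemma Syn_kmp u : Syn kmp u <-> infix w u.
Proof.
split=> [uS|wu].
  have [w0|w_gt0] := posnP (size w); first by rewrite (size0nil w0) infix0s.
  have nil_N : ~~ infix w [::] by rewrite infixs0 -size_eq0 -lt0n.
  have := kmp_run u nil_N; rewrite /= => <-.
  by rewrite (uS _ (ord_max : 'I_(size w).+1)) kmp_absorbing.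
suff all_max (q : state kmp) : delta_star q u = (ord_max : 'I_(size w).+1).
  by move=> q q'; rewrite !all_max.
have [->|qN] := eqVneq (q : 'I_(size w).+1) ord_max; first exact: kmp_absorbing.
rewrite -[q](overlap_take q); apply/eqP; rewrite kmp_run ?infix_catl //.
apply: contraNN qN => /size_infix; rewrite size_takel; last by rewrite -ltnS.
by move=> qw; rewrite -val_eqE eqn_leq qw -ltnS ltn_ord.
Qed.

End UpperBound.

Lemma principal_idealP (Sigma : finType) (w u : seq Sigma) :
  principal_ideal w u <-> infix w u.
Proof. by split=> [/infixP|/infixP]. Qed.

Theorem theorem5 (Sigma : finType) (Sigma_nonempty : 0 < #|Sigma|)
    (w : seq Sigma) :
  is_rc (principal_ideal w) (size w).+1.
Proof.
split=> [|A _ SynA].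
  exists (kmp w); split; last by rewrite card_ord.
    by exists w; apply/Syn_kmp/infix_refl.
  move=> u; apply: iff_trans (Syn_kmp w u) _.
  exact: iff_sym (principal_idealP w u).
apply: principal_lower_bound => u.
exact: iff_trans (SynA u) (principal_idealP w u).
Qed.
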